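(* Let $(M,d)$ be a metric space and let $S,T:M\to M$ be occasionally weakly compatible mappings satisfying the property (E.A.). Suppose that the pair $(S,T)$ is a $\psi-(\alpha,\beta,m)$-contraction pair. If $T(M)\subset M$ is closed, then $S$ and $T$ have a unique common fixed point, i.e. there exists a unique $z\in M$ with $Sz=Tz=z$.
   Context: Write $\mathbb{R}_+=[0,+\infty)$. An altering distance function is a function $\psi:\mathbb{R}_+\to\mathbb{R}_+$ that is continuous, monotonically non-decreasing, and satisfies $\psi(t)=0$ if and only if $t=0$; $\Psi$ denotes the set of all such functions. Let $(M,d)$ be a metric space and $S,T:M\to M$. The pair $(S,T)$ is called a $\psi-(\alpha,\beta,m)$-contraction pair if for all $x,y\in M$ $$\psi(d(Sx,Sy))\le \alpha(d(Tx,Ty))\,\psi(d(Tx,Ty))+\beta(d(Tx,Ty))\,\psi(m(x,y)),$$ where $\psi\in\Psi$; $\alpha,\beta:\mathbb{R}_+\to[0,1)$ are functions with $\alpha(t)+\beta(t)<1$ for all $t\in\mathbb{R}_+$, $\limsup_{s\to0^+}\beta(s)<1$, and $\limsup_{s\to t^+}\frac{\alpha(s)}{1-\beta(s)}<1$ for all $t>0$; and $$m(x,y):=\max\left\{d(Sy,Ty)\frac{1+d(Sx,Tx)}{1+d(Tx,Ty)},\ d(Tx,Ty)\right\}.$$ The pair $(S,T)$ satisfies the property (E.A.) if there exists a sequence $(x_n)_n\subset M$ such that $\lim_{n\to\infty}Sx_n=\lim_{n\to\infty}Tx_n=t$ for some $t\in M$. The pair $(S,T)$ is occasionally weakly compatible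 (OWC) if there exists $x\in M$ with $Sx=Tx$ and $STx=TSx$. *)

(* Defs.v *)
From HB Require Import structures.
From mathcomp Require Export all_boot all_order all_algebra.
From mathcomp Require Export all_classical all_reals all_analysis.
Export numFieldNormedType.Exports.
Set Implicit Arguments.
Unset Strict Implicit.
Unset Printing Implicit Defensive.
Import Order.TTheory GRing.Theory Num.Theory.
Local Open Scope classical_set_scope.
Local Open Scope ring_scope.

(* A function on [0, +oo) is represented by a total function R -> R whose
   values at negative arguments are unconstrained and never used; continuity is
   that of the restriction to [0, +oo), hence one-sided at 0. *)
Definition altering_distance (R : realType) (psi : R -> R) : Prop :=
  [/\ {in `[0, +oo[, forall t, 0 <= psi t},
      {within [set` `[0, +oo[], continuous psi},
      {in `[0, +oo[ &, {homo psi : s t / s <= t}} &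
      {in `[0, +oo[, forall t, psi t = 0 <-> t = 0}].

(* The limit superiors are taken in \bar R along the right neighborhoods t^'+,
   which exclude t itself. *)
Definition admissible_coeffs (R : realType) (alpha beta : R -> R) : Prop :=
  [/\ {in `[0, +oo[, forall t, 0 <= alpha t < 1},
      {in `[0, +oo[, forall t, 0 <= beta t < 1},
      {in `[0, +oo[, forall t, alpha t + beta t < 1},
      (limf_esup (fun s => (beta s)%:E) 0^'+ < 1%:E)%E &
      {in `]0, +oo[, forall t,
        (limf_esup (fun s => (alpha s / (1 - beta s))%:E) t^'+ < 1%:E)%E}].

Definition m_term (R : realType) (M : metricType R) (S T : M -> M) (x y : M)
    : R :=
  Num.max (mdist (S y) (T y) * ((1 + mdist (S x) (T x)) /
                                (1 + mdist (T x) (T y))))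
          (mdist (T x) (T y)).

Definition contraction_pair (R : realType) (M : metricType R)
    (psi alpha beta : R -> R) (S T : M -> M) : Prop :=
  [/\ altering_distance psi,
      admissible_coeffs alpha beta &
      forall x y : M,
        psi (mdist (S x) (S y)) <=
          alpha (mdist (T x) (T y)) * psi (mdist (T x) (T y)) +
          beta (mdist (T x) (T y)) * psi (m_term S T x y)].

Definition property_EA (R : realType) (M : metricType R) (S T : M -> M)
    : Prop :=
  exists (u : nat -> M) (t : M),
    S (u n) @[n --> \oo] --> t /\ T (u n) @[n --> \oo] --> t.

Definition occasionally_weakly_compatible (M : Type) (S T : M -> M) : Prop :=
  exists x : M, S x = T x /\ S (T x) = T (S x).

(* Main.v *)
Require Import Defs.
Import Order.TTheory GRing.Theory Num.Theory.
Local Open Scope classical_set_scope.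
Local Open Scope ring_scope.

(* At coincidence points x and y the first entry of m(x, y) vanishes, so the
   contraction inequality reads psi(d) <= (alpha(d) + beta(d)) psi(d) with
   d = d(Sx, Sy) = d(Tx, Ty), which forces d = 0: all coincidence points have
   the same image w. If x is the point given by occasional weak compatibility,
   w = Sx = Tx is itself a coincidence point, hence Sw = Sx = w. *)

Lemma contraction_pair_coincidence (R : realType) (M : metricType R)
    (psi alpha beta : R -> R) (S T : M -> M) (x y : M) :
  contraction_pair psi alpha beta S T -> S x = T x -> S y = T y -> S x = S y.
Proof.
case=> -[psi_ge0 _ _ psi_eq0] [_ _ ab_lt1 _ _] contr STx STy.
have := contr x y.
rewrite /m_term STx STy mdistxx mul0r max_r ?mdist_ge0//.
set d := mdist (T x) (T y) => le_psi.
have d_ge0 : d \in `[0, +oo[ by rewrite in_itv/= andbT mdist_ge0.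
(* Since [psi] vanishes only at 0 and is nonnegative, it suffices that [psi d <= 0]. *)
apply/mdist_positivity/(psi_eq0 d d_ge0)/eqP; rewrite eq_le psi_ge0// andbT.
have ab_gt0 : 0 < 1 - (alpha d + beta d) by rewrite subr_gt0 ab_lt1.
(* Multiplied by the positive factor [1 - (alpha d + beta d)], this is exactly [le_psi]. *)
by rewrite -(pmulr_rle0 _ ab_gt0) mulrBl mul1r mulrDl subr_le0.
Qed.

Arguments contraction_pair_coincidence {R M psi alpha beta S T x y}.

Theorem theorem3p2 (R : realType) (M : metricType R) (S T : M -> M)
    (psi alpha beta : R -> R)
    (owcST : occasionally_weakly_compatible S T)
    (eaST : property_EA S T)
    (contrST : contraction_pair psi alpha beta S T)
    (closedT : closed (range T)) :
  exists! z : M, S z = z /\ T z = z.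
Proof.
have [x [STx STTx]] := owcST.
have STw : S (S x) = T (S x) by rewrite -STTx STx.
have Sw := contraction_pair_coincidence contrST STw STx.
exists (S x); split=> [|z [Sz Tz]]; first by rewrite -STw.
(* A common fixed point [z] is a coincidence point with image [z], so [z] equals the common image
   [S x]. *)
rewrite -[RHS]Sz; apply: (contraction_pair_coincidence contrST STx).
by rewrite Sz Tz.
Qed.
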